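(* Given two vertices $w_{0}, w_{9}$ (not necessarily distinct) of the odd graph $O_{3}$ and elements $\lambda_{1}, \lambda_{2} \in \{1, 2, 3, 4, 5\}$ with $\lambda_{1} \notin [w_{0}]$ and $\lambda_{2} \notin [w_{9}]$, there exists a $9$-special walk from $w_{0}$ to $w_{9}$ such that its first edge is labeled with $\lambda_{1}$ and its last edge is labeled with $\lambda_{2}$.
   Context: The odd graph $O_{n}$ has one vertex for each $(n-1)$-element subset of $\{1, 2, \dots, 2n-1\}$, and two vertices are adjacent if and only if the corresponding subsets are disjoint. For a vertex $v$ of $O_n$, $[v]$ denotes the corresponding subset. Each edge $uv$ is labeled with the unique element of $\{1, \dots, 2n-1\}$ contained in neither $[u]$ nor $[v]$. A walk of length $k$ from $v_0$ to $v_k$ is a sequence of vertices $v_0 v_1 \dots v_k$ with consecutive vertices adjacent (vertices and edges may repeat); its edges are $v_0v_1, v_1v_2, \dots, v_{k-1}v_k$. A special walk is a walk in which every two consecutive edges are distinct. A $k$-special walk is a special walk of length $k$. *)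

(* Defs.v *)
From mathcomp Require Import all_boot.

Set Implicit Arguments.
Unset Strict Implicit.
Unset Printing Implicit Defensive.

(* The ordinal i : 'I_(2 * n - 1) stands for the element i + 1 of
   {1, ..., 2n - 1}. *)
Definition ground (n : nat) : finType := 'I_(2 * n - 1).

Definition odd_vertex (n : nat) : finType :=
  {A : {set ground n} | #|A| == n - 1}.

(* This is the edge relation of a simple graph only when 2 <= n: for n <= 1
   the single vertex is the empty set, which is disjoint from itself. *)
Definition odd_adj (n : nat) (u v : odd_vertex n) : bool :=
  [disjoint val u & val v].

(* For e = [set u; v] with u, v adjacent, this says that x is the unique
   element of the ground set contained in neither endpoint. *)
Definition edge_labeled (n : nat) (e : {set odd_vertex n}) (x : ground n) :
    bool :=
  ~: (\bigcup_(u in e) val u) == [set x].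

(* A walk v0 v1 ... vk is given by v0 and the sequence s = [:: v1; ...; vk]. *)
Definition is_walk (n k : nat) (v0 vk : odd_vertex n)
    (s : seq (odd_vertex n)) : bool :=
  [&& path (@odd_adj n) v0 s, size s == k & last v0 s == vk].

(* Edges are unordered pairs. *)
Definition walk_edges (n : nat) (v0 : odd_vertex n) (s : seq (odd_vertex n)) :
    seq {set odd_vertex n} :=
  pairmap (fun u v => [set u; v]) v0 s.

(* [sorted r] relates consecutive items only. *)
Definition special (n : nat) (v0 : odd_vertex n) (s : seq (odd_vertex n)) :
    bool :=
  sorted (fun e f => e != f) (walk_edges v0 s).

Definition special_walk (n k : nat) (v0 vk : odd_vertex n)
    (s : seq (odd_vertex n)) : bool :=
  is_walk k v0 vk s && special v0 s.

(* Main.v *)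
Require Import Defs.
From mathcomp Require Import all_boot.

Set Implicit Arguments.
Unset Strict Implicit.
Unset Printing Implicit Defensive.

(** In the odd graph O_3 the ground set has five elements, so an arc u -> v
    whose edge has label c splits it into the pair [u], the element c and the
    pair [v].  Listing these as a, b | c | d, e, the arcs that may follow
    u -> v in a special walk are exactly d, e | a | b, c and d, e | b | a, c:
    the label of the next edge lies in [u] (it avoids [v], and it differs from
    c because the next edge differs from uv), and the next vertex consists of
    the rest of [u] together with c.  Hence arcs are arrangements of the ground
    set, taken up to swapping the first two and the last two entries, and
    extending a special walk by one edge applies one of two fixed permutations
    of the five positions.

    Prescribing w0 and lambda1 amounts to prescribing the first arc, and
    prescribing w9 and lambda2 the last one.  So the theorem says that any arc
    can be turned into any other arc by eight moves.  Moves permute positions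
    and ignore which elements are listed ([move_map]), so it suffices to treat
    the starting arrangement 0, 1 | 2 | 3, 4 and all 120 targets, which is a
    computation ([reach_iota]).

    The number eight can be explained by counting.  From a given arc, exactly
    1, 2, 4, 8, 14, 23, 28, 29, 30 arcs are reached by 0, 1, ..., 8 moves; by
    symmetry the same numbers count the arcs from which a given arc is reached.
    There are 30 arcs and 23 + 8 > 30, so some arc is at once five moves after
    the first arc and three moves before the last one.  Seven moves miss one
    arc. *)

(** * Arrangements and moves *)

(** An arrangement a, b | c | d, e stands for the arc from {a, b} to {d, e}
    labeled c; the boolean chooses which of a and b labels the next edge. *)
Definition move (T : Type) (x : seq T) (i : bool) : seq T :=
  if x is [:: a; b; c; d; e] then
    if i then [:: d; e; b; a; c] else [:: d; e; a; b; c]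
  else x.

Lemma move_map (T U : Type) (f : T -> U) (x : seq T) (i : bool) :
  move (map f x) i = map f (move x i).
Proof. by case: x => [|a [|b [|c [|d [|e [|]]]]]] //=; case: i. Qed.

Lemma foldl_move_map (T U : Type) (f : T -> U) (x : seq T) (w : seq bool) :
  foldl (@move U) (map f x) w = map f (foldl (@move T) x w).
Proof. by elim: w x => //= i w IHw x; rewrite move_map IHw. Qed.

Lemma perm_move (T : eqType) (x : seq T) (i : bool) : perm_eq (move x i) x.
Proof.
case: x => [|a [|b [|c [|d [|e [|]]]]]] //.
apply/permP => p; case: i => /=; rewrite !addn0.
  by rewrite addnA addnC !addnA [p b + _]addnC -!addnA.
by rewrite addnA addnC -!addnA.
Qed.

(** On arrangements of the same elements this is equality of arcs: once the
    last three entries agree in this sense, the first two form equal pairs. *)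
Definition same_end (T : eqType) (x y : seq T) : bool :=
  if x is [:: _; _; c; d; e] then
    if y is [:: _; _; c'; d'; e'] then
      (c == c') && perm_eq [:: d; e] [:: d'; e']
    else false
  else false.

Definition words (n : nat) : seq (seq bool) :=
  iter n (fun ws => [seq i :: w | i <- [:: true; false], w <- ws]) [:: [::]].

Lemma reach_iota :
  all (fun y => has (fun w => (size w == 8) &&
                       same_end (foldl (@move nat) (iota 0 5) w) y) (words 8))
      (permutations (iota 0 5)).
Proof. by vm_compute. Qed.

(** Writing the target as a rearrangement of the positions of x reduces the
    claim to the standard arrangement, as moves commute with relabeling. *)
Lemma reach (T : eqType) (x y : seq T) :
    size x = 5 -> perm_eq y x ->
  exists2 w, size w = 8 & same_end (foldl (@move T) x w) y.
Proof.
move=> sz_x yx; have a0 : T by case: x sz_x {yx} => // a.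
have [p p_iota ->] := perm_iotaP a0 yx; rewrite sz_x in p_iota.
have /allP/(_ p) := reach_iota; rewrite mem_permutations => /(_ p_iota).
case/hasP => w _ /andP[/eqP sz_w ends]; exists w => //.
have def_x : map (nth a0 x) (iota 0 5) = x.
  by rewrite -sz_x map_nth_iota0 ?take_size.
rewrite -{1}def_x foldl_move_map; move: ends.
case: (foldl _ _ w) => [|? [|? [|? [|? [|? [|]]]]]] //.
case: p {p_iota} => [|? [|? [|? [|? [|? [|]]]]]] //= /andP[/eqP-> pq].
by rewrite eqxx; apply: (perm_map (nth a0 x) pq).
Qed.

(** * Arrangements of the ground set as arcs of the odd graph *)

(** The first argument is a default value, taken when a = b. *)
Definition pair_vertex (v0 : odd_vertex 3) (a b : ground 3) : odd_vertex 3 :=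
  insubd v0 [set a; b].

Lemma val_pair_vertex (v0 : odd_vertex 3) (a b : ground 3) :
  a != b -> val (pair_vertex v0 a b) = [set a; b].
Proof. by move=> ab; rewrite val_insubd cards2 ab. Qed.

Lemma pair_vertex_eq (v0 v : odd_vertex 3) (d e d' e' : ground 3) :
    val v = [set d'; e'] -> perm_eq [:: d; e] [:: d'; e'] ->
  pair_vertex v0 d e = v.
Proof.
move=> def_v /perm_mem eq_de; rewrite /pair_vertex.
suff -> : [set d; e] = val v by rewrite valKd.
by apply/setP=> z; move: (eq_de z); rewrite def_v !inE.
Qed.

Definition tail_vertex (v0 : odd_vertex 3) (x : seq (ground 3)) :=
  if x is [:: a; b; _; _; _] then pair_vertex v0 a b else v0.

Definition head_vertex (v0 : odd_vertex 3) (x : seq (ground 3)) :=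
  if x is [:: _; _; _; d; e] then pair_vertex v0 d e else v0.

Definition label (x : seq (ground 3)) : ground 3 := nth ord0 x 2.

Definition arc_edge (v0 : odd_vertex 3) (x : seq (ground 3)) :=
  [set tail_vertex v0 x; head_vertex v0 x].

Definition arrangement (x : seq (ground 3)) : bool :=
  perm_eq x (enum (ground 3)).

Lemma size_arrangement (x : seq (ground 3)) : arrangement x -> size x = 5.
Proof. by move/perm_size->; rewrite -cardE card_ord. Qed.

Lemma arrangement_uniq (x : seq (ground 3)) : arrangement x -> uniq x.
Proof. by move/perm_uniq->; apply: enum_uniq. Qed.

Lemma mem_arrangement (x : seq (ground 3)) z : arrangement x -> z \in x.
Proof. by move/perm_mem->; rewrite mem_enum. Qed.

Lemma arrangement_move (x : seq (ground 3)) i :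
  arrangement x -> arrangement (move x i).
Proof. exact/perm_trans/perm_move. Qed.

Lemma arc_adj (v0 : odd_vertex 3) (x : seq (ground 3)) :
  arrangement x -> odd_adj (tail_vertex v0 x) (head_vertex v0 x).
Proof.
move=> arr_x; move: (size_arrangement arr_x) (arrangement_uniq arr_x).
case: x {arr_x} => [|a [|b [|c [|d [|e [|]]]]]] //= _.
rewrite !inE !negb_or => /and5P[/and4P[ab _ ad ae] /and3P[_ bd be] _ de _].
rewrite /odd_adj !val_pair_vertex // -setI_eq0; apply/eqP/setP => z.
rewrite !inE; apply/negP => /andP[/orP[]/eqP-> /orP[]] => /eqP Dz.
- by rewrite Dz eqxx in ad.
- by rewrite Dz eqxx in ae.
- by rewrite Dz eqxx in bd.
- by rewrite Dz eqxx in be.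
Qed.

Lemma arc_labeled (v0 : odd_vertex 3) (x : seq (ground 3)) :
  arrangement x -> edge_labeled (arc_edge v0 x) (label x).
Proof.
move=> arr_x; have:= fun z => mem_arrangement z arr_x.
move: (size_arrangement arr_x) (arrangement_uniq arr_x).
case: x {arr_x} => [|a [|b [|c [|d [|e [|]]]]]] //= _.
rewrite !inE !negb_or => /and5P[/and4P[ab ac _ _] /and3P[bc _ _] /andP[cd ce]].
move=> de _ all_in; rewrite /edge_labeled /arc_edge bigcup_setU !big_set1 /=.
rewrite !val_pair_vertex //; apply/eqP/setP=> z; move: (all_in z).
rewrite !inE /label /=; case: (eqVneq z c) => [-> _|_].
  by rewrite ![c == _]eq_sym (negPf ac) (negPf bc) ![_ == c]eq_sym
    (negPf cd) (negPf ce).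
by rewrite -orbA => ->.
Qed.

(** * Walks traced by sequences of moves *)

Lemma edge_labeled_inj (n : nat) (f : {set odd_vertex n}) (y z : ground n) :
  edge_labeled f y -> edge_labeled f z -> y = z.
Proof. by rewrite /edge_labeled => /eqP-> /eqP/set1_inj. Qed.

(** Together with [arc_adj], this makes the heads of successive arrangements a
    walk. *)
Lemma tail_move (v0 : odd_vertex 3) (x : seq (ground 3)) i :
  size x = 5 -> tail_vertex v0 (move x i) = head_vertex v0 x.
Proof. by case: x => [|a [|b [|c [|d [|e [|]]]]]] //= _; case: i. Qed.

Lemma label_move (x : seq (ground 3)) i :
  arrangement x -> label (move x i) != label x.
Proof.
move=> arr_x; move: (size_arrangement arr_x) (arrangement_uniq arr_x).
case: x {arr_x} => [|a [|b [|c [|d [|e [|]]]]]] //= _.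
by rewrite !inE !negb_or => /and3P[/and4P[_ ac _ _] /and3P[bc _ _] _]; case: i.
Qed.

(** Consecutive edges of a walk traced by moves carry different labels, and an
    edge has only one label. *)
Lemma arc_edge_move (v0 : odd_vertex 3) (x : seq (ground 3)) i :
  arrangement x -> arc_edge v0 x != arc_edge v0 (move x i).
Proof.
move=> arr_x; apply: contra (label_move i arr_x) => /eqP eq_edge.
apply/eqP/(@edge_labeled_inj _ (arc_edge v0 x)); last exact: arc_labeled.
by rewrite eq_edge; apply/arc_labeled/arrangement_move.
Qed.

Definition arcs (x : seq (ground 3)) (w : seq bool) :=
  x :: scanl (@move (ground 3)) x w.

Definition walk (v0 : odd_vertex 3) (x : seq (ground 3)) (w : seq bool) :=
  map (head_vertex v0) (arcs x w).

Lemma last_arcs y (x : seq (ground 3)) (w : seq bool) :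
  last y (arcs x w) = foldl (@move (ground 3)) x w.
Proof. by elim: w x y => //= i w IHw x y; apply: IHw. Qed.

Lemma walk_edges_arcs (v0 : odd_vertex 3) (x : seq (ground 3)) (w : seq bool) :
    arrangement x ->
  walk_edges (tail_vertex v0 x) (walk v0 x w) = map (arc_edge v0) (arcs x w).
Proof.
elim: w x => [|i w IHw] x arr_x //; rewrite /walk /=; congr (_ :: _).
rewrite -(tail_move v0 i (size_arrangement arr_x)).
exact: (IHw _ (arrangement_move i arr_x)).
Qed.

Lemma walk_special (v0 : odd_vertex 3) (x : seq (ground 3)) (w : seq bool) :
    arrangement x ->
  special_walk (size w).+1 (tail_vertex v0 x)
    (head_vertex v0 (foldl (@move (ground 3)) x w)) (walk v0 x w).
Proof.
move=> arr_x; rewrite /special_walk /is_walk size_map /= size_scanl eqxx.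
rewrite -[last _ _]/(last (head_vertex v0 x) (walk v0 x w)) last_map last_arcs.
rewrite eqxx arc_adj // andbT /special walk_edges_arcs //=.
elim: w x arr_x => //= i w IHw x arr_x.
have arr_y := arrangement_move i arr_x; have := IHw _ arr_y.
rewrite !andbT => /andP[-> ->]; rewrite arc_edge_move // !andbT.
by rewrite -(tail_move v0 i (size_arrangement arr_x)) arc_adj.
Qed.

(** A vertex and a label outside it determine an arc leaving that vertex, and
    read backwards an arc entering it; hence this provides the arrangements at
    both ends of the walk. *)
Lemma arrangement_from (v : odd_vertex 3) (c : ground 3) :
    c \notin val v ->
  exists a b d e, arrangement [:: a; b; c; d; e] /\ val v = [set a; b].
Proof.
move=> cv; have /cards2P[a [b [ab def_v]]] := valP v.
have card_rest : #|~: (c |: val v)| == 2.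
  have := cardsC (c |: val v).
  by rewrite cardsU1 cv (eqP (valP v)) card_ord => /eqP; rewrite eqn_add2l.
have /cards2P[d [e [de def_rest]]] := card_rest.
exists a, b, d, e; split=> //.
have mem_x z : z \in [:: a; b; c; d; e].
  have := in_setC z (c |: val v); rewrite def_rest def_v !inE.
  by case: (z == a); case: (z == b); case: (z == c); case: (z == d).
have sub_x : {subset enum (ground 3) <= [:: a; b; c; d; e]} by move=> z _.
have sz_x : size [:: a; b; c; d; e] <= size (enum (ground 3)).
  by rewrite -cardE card_ord.
have uniq_x := leq_size_uniq (enum_uniq _) sub_x sz_x.
by apply: uniq_perm => // [|z]; rewrite ?enum_uniq // mem_x mem_enum.
Qed.

Theorem theorem2p2 (w0 w9 : odd_vertex 3) (lambda1 lambda2 : ground 3)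
    (h1 : lambda1 \notin val w0) (h2 : lambda2 \notin val w9) :
  exists s : seq (odd_vertex 3),
    [/\ special_walk 9 w0 w9 s,
        edge_labeled (head set0 (walk_edges w0 s)) lambda1
      & edge_labeled (last set0 (walk_edges w0 s)) lambda2].
Proof.
have [a [b [d [e [arr_x def_w0]]]]] := arrangement_from h1.
have [d' [e' [a' [b' [arr_y def_w9]]]]] := arrangement_from h2.
set x := [:: a; b; lambda1; d; e] in arr_x.
(* An arrangement adapted to w9 starts with w9; the last arc must end there,
   so the target is its reversal. *)
have yx : perm_eq [:: b'; a'; lambda2; e'; d'] x.
  rewrite (perm_rev [:: d'; e'; lambda2; a'; b']) (permPl arr_y).
  by rewrite perm_sym.
have [w sz_w ends] := reach (size_arrangement arr_x) yx.
have tail_x : tail_vertex w0 x = w0.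
  exact: pair_vertex_eq def_w0 (perm_refl _).
have [label_z head_z] : label (foldl (@move _) x w) = lambda2
    /\ head_vertex w0 (foldl (@move _) x w) = w9.
  move: ends; case: (foldl _ x w) => [|? [|? [|? [|d1 [|e1 [|]]]]]] //=.
  case/andP=> /eqP-> de; split=> //; apply: pair_vertex_eq def_w9 _.
  by apply: perm_trans de _; rewrite (perm_catC [:: _] [:: _]).
have arr_z : arrangement (foldl (@move _) x w).
  by elim: w (x) arr_x {sz_w ends label_z head_z} => //= i w IHw z arr_z;
    apply/IHw/arrangement_move.
exists (walk w0 x w); split.
- by have := walk_special w0 w arr_x; rewrite sz_w tail_x head_z.
- by rewrite -{1}tail_x walk_edges_arcs //; apply: arc_labeled.
- rewrite -{1}tail_x walk_edges_arcs // /arcs /= last_map.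
  by have := last_arcs x x w; rewrite /= => ->; rewrite -label_z arc_labeled.
Qed.
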